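(* Let $\omega=(\omega_x)_{x\in\mathbb{Z}}$ be a random environment, i.e. a sequence of i.i.d. random variables with values in $(0,1)$ under a probability measure $\mathsf{P}$, such that, with $\rho_0:=\frac{1-\omega_0}{\omega_0}$: (i) $\mathsf{E}[\log\rho_0]=0$; (ii) $\mathsf{P}(\varepsilon\le\omega_0\le 1-\varepsilon)=1$ for some $\varepsilon\in(0,\tfrac12)$; (iii) $\mathsf{Var}(\log\rho_0)>0$. Let $(X_n)_{n\in\mathbb{N}_0}$ be the random walk in the environment $\omega$ started at $0$, with quenched law $P_\omega$. Then for every $\alpha>0$, $$\sum_{n\in\mathbb{N}}\big(P_\omega(X_{2n}=0)\big)^{\alpha}=\infty$$ for $\mathsf{P}$-a.e. environment $\omega$.
   Context: $\mathbb{N}=\{1,2,\dots\}$, $\mathbb{N}_0=\mathbb{N}\cup\{0\}$. For a fixed environment $\omega=(\omega_x)_{x\in\mathbb{Z}}\in(0,1)^{\mathbb{Z}}$ and $x\in\mathbb{Z}$, under $P_\omega^x$ the process $(X_n)_{n\in\mathbb{N}_0}$ is the Markov chain on $\mathbb{Z}$ with $P_\omega^x(X_0=x)=1$ and $P_\omega^x(X_{n+1}=y+1\mid X_n=y)=\omega_y=1-P_\omega^x(X_{n+1}=y-1\mid X_n=y)$ for all $y\in\mathbb{Z}$. $P_\omega:=P_\omega^0$. *)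

(* Defs.v *)
From HB Require Import structures.
From mathcomp Require Import all_boot all_order all_algebra.
From mathcomp Require Import all_classical all_reals all_analysis.

Set Implicit Arguments.
Unset Strict Implicit.
Unset Printing Implicit Defensive.

Import Order.TTheory GRing.Theory Num.Theory.

Local Open Scope classical_set_scope.
Local Open Scope ring_scope.

Section iid.
Context {d : measure_display} {T : measurableType d} {R : realType}.
Variables (P : probability T R) (I : choiceType) (Y : I -> {RV P >-> R}).

Definition mutually_independent : Prop :=
  forall (s : seq I) (A : I -> set R),
    uniq s -> (forall i, measurable (A i)) ->
    P (\bigcap_(i in [set` s]) (Y i @^-1` A i)) =
    (\prod_(i <- s) P (Y i @^-1` A i))%E.

Definition identically_distributed : Prop :=
  forall (i j : I) (A : set R), measurable A ->
    distribution P (Y i) A = distribution P (Y j) A.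

Definition iid : Prop := mutually_independent /\ identically_distributed.

End iid.

Section markov_chain.
Context {d : measure_display} {S : measurableType d} {R : realType}.
Variables (Q : probability S R) (X : nat -> S -> int).

(* Junk value 0 when Q B = 0; every use below is guarded by Q B != 0. *)
Definition cond_prob (A B : set S) : R := fine (Q (A `&` B)) / fine (Q B).

Definition history (n : nat) (s : nat -> int) : set S :=
  \bigcap_(k in [set k | (k <= n)%N]) [set u | X k u = s k].

Definition markov_property : Prop :=
  forall (n : nat) (s : nat -> int) (z : int),
    Q (history n s) != 0%E ->
    cond_prob [set u | X n.+1 u = z] (history n s) =
    cond_prob [set u | X n.+1 u = z] [set u | X n u = s n].

(* The first clause is measurability of each X n for the discrete
   sigma-algebra on the countable set int. *)
Definition walk_in_environment (e : int -> R) (x : int) : Prop :=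
  [/\ forall (n : nat) (y : int), measurable [set u | X n u = y],
      Q [set u | X 0%N u = x] = 1%E,
      markov_property
    & forall (n : nat) (y : int), Q [set u | X n u = y] != 0%E ->
        cond_prob [set u | X n.+1 u = y + 1] [set u | X n u = y] = e y /\
        e y = 1 - cond_prob [set u | X n.+1 u = y - 1] [set u | X n u = y]].

End markov_chain.

(* PQ e x is the quenched law of the walk X in the environment e started
   at x. *)
Definition quenched_laws {d : measure_display} {S : measurableType d}
    {R : realType} (X : nat -> S -> int)
    (PQ : (int -> R) -> int -> probability S R) : Prop :=
  forall (e : int -> R) (x : int),
    (forall y, 0 < e y < 1) -> walk_in_environment (PQ e x) X e x.

Definition rho {R : realType} (w : R) : R := (1 - w) / w.

(* Main.v *)
Require Import Defs.
From HB Require Import structures.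
From mathcomp Require Import all_boot all_order all_algebra.
From mathcomp Require Import all_classical all_reals all_analysis.
From mathcomp Require Import measurable_realfun.
From mathcomp Require Import ring lra zify.

Import Order.TTheory GRing.Theory Num.Theory.

Local Open Scope classical_set_scope.
Local Open Scope ring_scope.

(* Let V be the potential, V(x+1) - V(x) = log rho_(x+1), so that the weights
   mu(x) = exp(-V(x)) / omega_x make the walk reversible.  Reversibility gives
   P^0(X_k = y) <= mu(y) / mu(0), so the walk needs a time of order e^h to leave
   an interval at whose ends V is at least h; up to that time, Cauchy-Schwarz
   gives P^0(X_2n = 0) >= mu(0) P^0(X_n in I)^2 / mu(I).  Hence an interval
   ("valley") of size at most h^3 on each side of 0 on which V >= - delta h
   contributes about e^h (e^(-delta h) / h^3)^alpha to the series, which is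
   unbounded once delta is small.

   Almost surely there are valleys of arbitrarily large height h: conditionally
   on any finite part of the environment, a fresh stretch of the mean-zero walk V
   reaches 2h before - delta h / 2 within O(h^2) steps with probability at least
   delta / 16 (optional stopping for the linear and the quadratic martingale),
   on each side of 0, so that the probability that no valley has been seen
   decreases geometrically. *)

(** * Return probabilities in a valley *)

Section reversible_matrix.
Context {R : realFieldType} {n : nat}.
Variables (K : 'M[R]_n.+1) (mu : 'I_n.+1 -> R).
Hypothesis mu_gt0 : forall i, 0 < mu i.
Hypothesis K_ge0 : forall i j, 0 <= K i j.
Hypothesis K_rev : forall i j, mu i * K i j = mu j * K j i.
Hypothesis K_sub : forall i, \sum_j K i j <= 1.

Lemma mxX_rev m i j : mu i * (K ^+ m) i j = mu j * (K ^+ m) j i.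
Proof.
elim: m i j => [|m IH] i j.
  by rewrite expr0 !mxE eq_sym; case: eqP => [->|_]; rewrite ?mulr0.
rewrite [in LHS]exprS [in RHS]exprSr -!mulmxE !mxE !mulr_sumr.
apply: eq_bigr => k _.
by rewrite mulrA K_rev [RHS]mulrA -IH mulrAC.
Qed.

Lemma mxX_ge0 m i j : 0 <= (K ^+ m) i j.
Proof.
elim: m i j => [|m IH] i j; first by rewrite expr0 mxE ler0n.
by rewrite exprS -mulmxE mxE sumr_ge0// => k _; rewrite mulr_ge0.
Qed.

Lemma mxX_sub m i : \sum_j (K ^+ m) i j <= 1.
Proof.
elim: m i => [|m IH] i.
  rewrite expr0 (bigD1 i)//= big1 ?addr0 ?mxE ?eqxx// => j /negbTE ji.
  by rewrite mxE eq_sym ji.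
rewrite exprS -mulmxE; under eq_bigr do rewrite mxE.
rewrite exchange_big /=; under eq_bigr do rewrite -mulr_sumr.
by rewrite (le_trans _ (K_sub i))// ler_sum// => k _; rewrite ler_piMr.
Qed.

Lemma mxX_le1 m i j : (K ^+ m) i j <= 1.
Proof.
rewrite (le_trans _ (mxX_sub m i))// (bigD1 j)//= lerDl sumr_ge0// => k _.
exact: mxX_ge0.
Qed.

(* B contains the states from which mass is lost; by reversibility they are
   visited at any given time with probability at most mu k / mu i. *)
Lemma mxX_mass (B : pred 'I_n.+1) m i :
  (forall k, 1 - \sum_j K k j <= (B k)%:R) ->
  1 - m%:R * (\sum_(k | B k) mu k / mu i) <= \sum_j (K ^+ m) i j.
Proof.
move=> KB; elim: m => [|m IH].
  rewrite mul0r subr0 expr0 (bigD1 i)//= mxE eqxx lerDl sumr_ge0// => k _.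
  by rewrite mxE ler0n.
rewrite exprSr -mulmxE; under [leRHS]eq_bigr do rewrite mxE.
rewrite [leRHS]exchange_big /=; under [leRHS]eq_bigr do rewrite -mulr_sumr.
have step : \sum_j (K ^+ m) i j - \sum_(k | B k) mu k / mu i <=
    \sum_k (K ^+ m) i k * \sum_j K k j.
  rewrite lerBlDr -lerBlDl -sumrB [leRHS]big_mkcond/= ler_sum// => k _.
  rewrite -[X in X - _]mulr1 -mulrBr.
  have Kki : (K ^+ m) i k <= mu k / mu i.
    rewrite ler_pdivlMr// mulrC mxX_rev ler_piMr ?mxX_le1// ltW//.
  case: ifPn => Bk; last first.
    by rewrite mulr_ge0_le0 ?mxX_ge0// (le_trans (KB k))// (negbTE Bk).
  by rewrite (le_trans _ Kki)// ler_piMr ?mxX_ge0// (le_trans (KB k))// lern1 leq_b1.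
apply: le_trans step; rewrite -natr1 mulrDl mul1r opprD addrA lerD2r.
exact: IH.
Qed.

(** The weighted squared deviation of [a j / mu j] from its mean [S / M] is nonnegative; expanding
    it gives the inequality divided by [M]. *)
Lemma cauchy_schwarz_weighted (a : 'I_n.+1 -> R) :
  (\sum_j a j) ^+ 2 <= (\sum_j a j ^+ 2 / mu j) * \sum_j mu j.
Proof.
set S := \sum_j a j; set M := \sum_j mu j.
have M_gt0 : 0 < M.
  rewrite /M (bigD1 ord0)//= ltr_pwDl// sumr_ge0// => j _; exact: ltW.
have : 0 <= \sum_j mu j * (a j / mu j - S / M) ^+ 2.
  by rewrite sumr_ge0// => j _; rewrite mulr_ge0 ?sqr_ge0// ltW.
have -> : \sum_j mu j * (a j / mu j - S / M) ^+ 2 =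
    \sum_j a j ^+ 2 / mu j - S ^+ 2 / M.
  under eq_bigr => j _.
    have -> : mu j * (a j / mu j - S / M) ^+ 2 =
      a j ^+ 2 / mu j + (- (2 * S / M) * a j + (S / M) ^+ 2 * mu j).
      by field; rewrite !gt_eqF.
    over.
  rewrite !big_split/= -!mulr_sumr -/S -/M; congr (_ + _).
  by field; rewrite gt_eqF.
by rewrite subr_ge0 ler_pdivrMr.
Qed.

(** A return in [2 * m] steps passes through some [j] at time [m], and reversibility turns the way
    back into the way out, so the diagonal entry is [mu i] times a weighted sum of squares.
    Cauchy-Schwarz bounds that sum below by the mass surviving at time [m]. *)
Lemma mxX_return m i :
  (\sum_j (K ^+ m) i j) ^+ 2 * mu i <= (K ^+ (2 * m)) i i * \sum_j mu j.
Proof.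
have -> : (K ^+ (2 * m)) i i = mu i * \sum_j (K ^+ m) i j ^+ 2 / mu j.
  rewrite mul2n -addnn exprD -mulmxE mxE mulr_sumr; apply: eq_bigr => j _.
  apply: (mulfI (lt0r_neq0 (mu_gt0 j))).
  rewrite mulrCA -mxX_rev expr2; field.
  by rewrite gt_eqF.
rewrite mulrC -mulrA ler_pM2l//; exact: cauchy_schwarz_weighted.
Qed.

End reversible_matrix.

(** * The walk killed on leaving an interval *)

Section killed_walk.
Context {R : realType}.
Variables (e : int -> R) (L n : nat).
Hypothesis e01 : forall x, 0 < e x < 1.

(* Index [i] stands for the site [i - L]. *)
Definition site (i : nat) : int := i%:Z - L%:Z.

(** A step out of the sites [- L, ..., n - L] has no column to go to, so mass is lost at the two end
    sites only, and the powers describe the walk killed on exit. *)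
Definition killed_mx : 'M[R]_n.+1 := \matrix_(i, j)
  (e (site i) * (j == i.+1 :> nat)%:R + (1 - e (site i)) * (i == j.+1 :> nat)%:R).

Lemma killed_mx_ge0 i j : 0 <= killed_mx i j.
Proof.
by have := e01 (site i); rewrite mxE => /andP[e0 e1];
   rewrite addr_ge0// mulr_ge0// ?ler0n// ?subr_ge0 ltW.
Qed.

Lemma sum_ord_eq m : \sum_(j < n.+1) (j == m :> nat)%:R = (m <= n)%:R :> R.
Proof.
case: (leqP m n) => mn.
  rewrite (bigD1 (inord m))//= inordK// eqxx big1 ?addr0// => j jm.
  case: eqP => // jE; move: jm; rewrite -jE inord_val eqxx //.
by rewrite big1// => j _; case: eqP => // jm; move: (ltn_ord j); rewrite jm ltnNge mn.
Qed.

Lemma sum_killed_mx i : \sum_j killed_mx i j =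
  e (site i) * (i < n)%:R + (1 - e (site i)) * (0 < i)%:R.
Proof.
under eq_bigr do rewrite mxE.
rewrite big_split/= -!mulr_sumr sum_ord_eq; congr (_ + _ * _).
case: i => -[|i] ilt /=; first by rewrite big1.
under eq_bigr do rewrite eqSS eq_sym.
by rewrite sum_ord_eq; have -> : (i <= n)%N by lia.
Qed.

Lemma sum_killed_mx_le1 i : \sum_j killed_mx i j <= 1.
Proof.
rewrite sum_killed_mx; have /andP[e0 e1] := e01 (site i).
case: (_ < n)%N; case: (0 < _)%N => /=; lra.
Qed.

Lemma killed_mx_loss i :
  1 - \sum_j killed_mx i j <= ((i == ord0) || (i == ord_max))%:R.
Proof.
rewrite sum_killed_mx; have /andP[e0 e1] := e01 (site i).
have -> : (0 < i)%N = (i != ord0) by rewrite lt0n.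
have -> : (i < n)%N = (i != ord_max).
  by rewrite ltn_neqAle -ltnS ltn_ord andbT.
case: eqP => _; case: eqP => _ /=; lra.
Qed.

Section domination.
Context {d : measure_display} {S : measurableType d}.
Variables (Q : probability S R) (X : nat -> S -> int).

(** Multiplying the transition probabilities by the probability of the condition removes the guard
    against null events: if [X m = y] has probability 0, both sides vanish. *)
Lemma walk_step x0 m y : walk_in_environment Q X e x0 ->
  e y * fine (Q [set u | X m u = y]) =
    fine (Q ([set u | X m.+1 u = y + 1] `&` [set u | X m u = y])) /\
  (1 - e y) * fine (Q [set u | X m u = y]) =
    fine (Q ([set u | X m.+1 u = y - 1] `&` [set u | X m u = y])).
Proof.
move=> [mX _ _ tr]; have [Q0|Q0] := eqVneq (Q [set u | X m u = y]) 0%E.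
  have Q0' A : measurable A -> Q (A `&` [set u | X m u = y]) = 0%E.
    move=> mA; apply/eqP; rewrite -measure_le0 -Q0 le_measure// inE//.
    exact: measurableI.
  by rewrite Q0 !Q0'//= !mulr0.
have Qf : fine (Q [set u | X m u = y]) != 0.
  by rewrite fine_eq0// fin_num_measure.
have [e1 e2] := tr m y Q0; split; first by rewrite -e1 divfK.
by rewrite e2 subKr divfK.
Qed.

(** Induction on [m]: the event [X m.+1 = site j] is split according to the position at time [m].
    Positions outside the interval are dropped, hence an inequality. *)
Lemma killed_mx_dominated (i0 : 'I_n.+1) m j :
  walk_in_environment Q X e (site i0) ->
  (killed_mx ^+ m) i0 j <= fine (Q [set u | X m u = site j]).
Proof.
move=> wQ; have [mX X0 _ _] := wQ.
elim: m j => [|m IH] j.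
  rewrite expr0 mxE; case: eqP => [<-|_]; last exact: fine_ge0.
  by rewrite X0.
pose F (i : 'I_n.+1) := [set u | X m.+1 u = site j] `&` [set u | X m u = site i].
have mF i : measurable (F i) by exact: measurableI.
have tF : trivIset setT F.
  apply/trivIsetP => i k _ _ ik; rewrite -subset0 => u [[_ /= ui] [_ /= uk]].
  move: ik; apply/negP; rewrite negbK; apply/eqP/val_inj.
  by move: uk; rewrite ui => /addIr[].
have QF : \sum_i fine (Q (F i)) <= fine (Q [set u | X m.+1 u = site j]).
  rewrite -lee_fin -sumEFin fineK ?fin_num_measure//.
  under eq_bigr do rewrite fineK ?fin_num_measure//.
  apply: (@le_trans _ _ (Q (\big[setU/set0]_(i < n.+1) F i))).
    by rewrite measure_bigsetU_ord.
  rewrite le_measure// ?inE//; first exact: bigsetU_measurable.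
  by apply: (big_ind (fun A => A `<=` _)) => // [A B AS BS u [/AS|/BS]//|i _ u []].
apply: le_trans QF; rewrite exprSr -mulmxE mxE ler_sum// => i _.
have [s1 s2] := walk_step _ m (site i) wQ.
apply: (le_trans (ler_wpM2r (killed_mx_ge0 i j) (IH i))).
rewrite mxE mulrC mulrDl ![_ * _%:R]mulrC -!mulrA s1 s2.
case: eqP => [ji|_]; case: eqP => [ij|_].
- by move: ij; rewrite ji; lia.
- rewrite mul1r mul0r addr0 /F; suff -> : site j = site i + 1 by [].
  by rewrite /site ji; lia.
- rewrite mul1r mul0r add0r /F; suff -> : site j = site i - 1 by [].
  by rewrite /site ij; lia.
- by rewrite !mul0r addr0 fine_ge0.
Qed.

End domination.
End killed_walk.

(** * Lower bound for the return probability at the bottom of a valley *)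

Section return_probability.
Context {R : realType} {d : measure_display} {S : measurableType d}.
Variables (Q : probability S R) (X : nat -> S -> int) (e : int -> R).
Variables (V : int -> R) (eps : R).
Hypothesis e01 : forall x, 0 < e x < 1.
Hypothesis eps_gt0 : 0 < eps.
Hypothesis e_ge : forall x, eps <= e x.
Hypothesis V0 : V 0 = 0.
Hypothesis VS : forall x : int, V (x + 1) = V x + ln (rho (e (x + 1))).
Hypothesis wQ : walk_in_environment Q X e 0.

(** Both sides equal [expR (- V x)], the conductance of the edge between [x] and [x + 1], because
    [V] increases by the logarithm of [rho (e (x + 1))] there. *)
Lemma detailed_balance x :
  expR (- V x) / e x * e x =
  expR (- V (x + 1)) / e (x + 1) * (1 - e (x + 1)).
Proof.
have /andP[ex0 _] := e01 x; have /andP[ey0 ey1] := e01 (x + 1).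
rewrite divfK ?gt_eqF// -mulrA [_^-1 * _]mulrC -/(rho _).
rewrite VS opprD expRD [expR (- ln _)]expRN lnK.
  by rewrite mulfVK// gt_eqF// divr_gt0// subr_gt0.
by rewrite posrE divr_gt0// subr_gt0.
Qed.

(** The height [h] of the two ends keeps the walk inside up to time [m] with probability at least
    1/2, and the depth [b] bounds the total weight of the interval; [mxX_return] combines the
    two. *)
Lemma return_prob_ge (l r : nat) (h b : R) (m : nat) :
  h <= V r%:Z -> h <= V (- l%:Z) ->
  (forall x : int, - l%:Z <= x <= r%:Z -> - b <= V x) ->
  4 * m%:R <= eps * expR h ->
  eps * expR (- b) / (4 * (l + r).+1%:R) <=
  fine (Q [set u | X (2 * m)%N u = 0]).
Proof.
move=> hr hl hb hm.
pose n := (l + r)%N.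
pose i0 : 'I_n.+1 := inord l.
have li0 : site l i0 = 0 by rewrite /site inordK ?subrr// ltnS leq_addr.
pose K := killed_mx e l n.
pose mu (i : 'I_n.+1) := expR (- V (site l i)) / e (site l i).
have mu_gt0 i : 0 < mu i.
  by rewrite divr_gt0 ?expR_gt0//; have /andP[] := e01 (site l i).
have K_rev i j : mu i * K i j = mu j * K j i.
  rewrite !mxE /mu.
  case: eqP => [ji|_]; case: eqP => [ij|_]; rewrite ?(mulr0,mulr1,addr0,add0r)//.
  - by move: ij; rewrite ji; lia.
  - have -> : site l j = site l i + 1 by rewrite /site ji; lia.
    exact: detailed_balance.
  - have -> : site l i = site l j + 1 by rewrite /site ij; lia.
    by rewrite detailed_balance.
have mu_le (i : 'I_n.+1) c : - c <= V (site l i) -> mu i <= expR c / eps.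
  move=> cV; have /andP[e0 _] := e01 (site l i).
  rewrite /mu; apply: ler_pM; rewrite ?expR_ge0 ?invr_ge0 ?(ltW e0)//.
    by rewrite ler_expR lerNl.
  by rewrite lef_pV2 ?posrE.
have mu0 : 1 <= mu i0.
  have /andP[e0 e1] := e01 0.
  by rewrite /mu li0 V0 oppr0 expR0 mul1r invf_ge1// ltW.
have Kge0 := @killed_mx_ge0 R e l n e01.
have Ksub := @sum_killed_mx_le1 R e l n e01.
have Kloss := @killed_mx_loss R e l n e01.
(* Each of the at most two ends has relative weight at most [expR (- h) / eps], so the loss in [m]
   steps is at most [2 * m * expR (- h) / eps], which [hm] bounds by 1/2. *)
have mass : 1 / 2 <= \sum_j (K ^+ m) i0 j.
  apply: le_trans (mxX_mass K mu mu_gt0 Kge0 K_rev Ksub _ m i0 Kloss).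
  have bd : \sum_(k | (k == ord0) || (k == ord_max)) mu k / mu i0 <=
      2 * (expR (- h) / eps).
    have mub k : (k == ord0) || (k == ord_max) -> mu k / mu i0 <= expR (- h) / eps.
      move=> kb; rewrite ler_pdivrMr// (@le_trans _ _ (expR (- h) / eps))//.
        apply: mu_le; rewrite opprK.
        by case/orP: kb => /eqP ->; rewrite /site/= ?sub0r// PoszD addrC addKr.
      by rewrite ler_peMr// divr_ge0 ?expR_ge0 ?ltW.
    apply: (le_trans (ler_sum _ mub)); rewrite sumr_const -[_ *+ _]mulr_natl.
    rewrite ler_wpM2r ?divr_ge0 ?expR_ge0 ?(ltW eps_gt0)// ler_nat.
    have card2 := cards2 (ord0 : 'I_n.+1) ord_max.
    apply: (@leq_trans #|[set ord0; ord_max : 'I_n.+1]|%SET).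
      by rewrite subset_leq_card//; apply/fintype.subsetP => k; rewrite !inE.
    by rewrite card2; case: (_ != _).
  rewrite lerBrDr -lerBrDl; apply: (le_trans (ler_wpM2l (ler0n _ _) bd)).
  have -> : m%:R * (2 * (expR (- h) / eps)) = (4 * m%:R) / (eps * expR h) / 2.
    by rewrite expRN; field; rewrite !gt_eqF ?expR_gt0.
  have : 4 * m%:R / (eps * expR h) <= 1.
    by rewrite ler_pdivrMr ?mul1r ?mulr_gt0 ?expR_gt0.
  lra.
have ret := mxX_return K mu mu_gt0 K_rev m i0.
have dom : (K ^+ (2 * m)) i0 i0 <= fine (Q [set u | X (2 * m)%N u = 0]).
  rewrite -[X in [set u | _ = X]]li0; apply: killed_mx_dominated => //.
  by rewrite li0.
apply: le_trans dom.
have smu : \sum_j mu j <= n.+1%:R * (expR b / eps).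
  apply: (@le_trans _ _ (\sum_(j < n.+1) expR b / eps)).
    apply: ler_sum => j _; apply: mu_le; apply: hb.
    by have := ltn_ord j; rewrite /site /n; lia.
  by rewrite sumr_const card_ord -[_ *+ _]mulr_natl.
have K0 := @mxX_ge0 R n K Kge0 (2 * m) i0 i0.
(* The constant is the square of the surviving mass 1/2; the weight of the origin is at least 1. *)
have : 1 / 4 <= (K ^+ (2 * m)) i0 i0 * (n.+1%:R * (expR b / eps)).
  apply: le_trans (ler_wpM2l K0 smu); apply: le_trans ret.
  have : (1 / 2) ^+ 2 <= (\sum_j (K ^+ m) i0 j) ^+ 2.
    by rewrite lerXn2r ?nnegrE//; lra.
  nra.
have -> : eps * expR (- b) / (4 * n.+1%:R) = 1 / 4 / (n.+1%:R * (expR b / eps)).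
  by rewrite expRN; field; rewrite !gt_eqF ?expR_gt0//= addrC natr1 pnatr_eq0.
by move=> H; rewrite ler_pdivrMr// mulr_gt0 ?ltr0n// divr_gt0// expR_gt0.
Qed.

End return_probability.

(** * Independence and a conditional hitting estimate *)

Lemma bounded_integrable {d} {T : measurableType d} {R : realType}
    (P : probability T R) (Z : T -> R) (c : R) :
  measurable_fun setT Z -> (forall t, `|Z t| <= c) ->
  P.-integrable setT (EFin \o Z).
Proof.
move=> mZ Zc; apply: measurable_bounded_integrable => //.
  by rewrite -ge0_fin_numE// fin_num_measure.
exists c; split; first exact: num_real.
by move=> x cx t _ /=; rewrite (le_trans (Zc t))// ltW.
Qed.

(** The joint law agrees with the product of the marginal laws on rectangles, hence everywhere, and
    Fubini factors the integral. *)
Lemma expectation_prod_indep {d} {T : measurableType d} {R : realType}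
    (P : probability T R) (X Y : T -> R) (a b : R) :
  measurable_fun setT X -> measurable_fun setT Y ->
  (forall t, `|X t| <= a) -> (forall t, `|Y t| <= b) ->
  (forall A B, measurable A -> measurable B ->
     P (X @^-1` A `&` Y @^-1` B) = (P (X @^-1` A) * P (Y @^-1` B))%E) ->
  \int[P]_t (X t * Y t) = (\int[P]_t X t) * \int[P]_t Y t.
Proof.
move=> mX mY Xa Yb XYind.
have iX := bounded_integrable P X a mX Xa.
have iY := bounded_integrable P Y b mY Yb.
have mXY : measurable_fun setT (fun t => (X t, Y t)).
  exact/measurable_fun_pairP.
have iXY : P.-integrable setT (EFin \o (fun t => X t * Y t)).
  apply: (bounded_integrable P _ (a * b)); first exact: measurable_funM.
  by move=> t; rewrite normrM ler_pM.
pose X' : {RV P >-> R} := MeasurableFun.Pack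
  (MeasurableFun.Class (isMeasurableFun.Build _ _ _ _ _ mX)).
pose Y' : {RV P >-> R} := MeasurableFun.Pack
  (MeasurableFun.Class (isMeasurableFun.Build _ _ _ _ _ mY)).
pose XY' : {RV P >-> (R * R)%type} := MeasurableFun.Pack
  (MeasurableFun.Class (isMeasurableFun.Build _ _ _ _ _ mXY)).
pose f (z : R * R) := (z.1 * z.2)%:E.
have mf : measurable_fun setT f.
  apply/measurable_EFinP; apply: measurable_funM;
    [exact: measurable_fst|exact: measurable_snd].
have joint A : measurable A ->
    (distribution P X' \x distribution P Y')%E A = distribution P XY' A.
  by move=> mA; apply: product_measure_unique => // B C mB mC; rewrite /= -XYind.
have i12 : (distribution P X' \x distribution P Y')%E.-integrable setT f.
  apply/integrableP; split => //.
  rewrite (eq_measure_integral (distribution P XY')); last first.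
    by move=> A mA _; exact: joint.
  rewrite ge0_integral_distribution//; last exact: measurableT_comp.
  by have /integrableP[] := iXY.
have E1 : (\int[P]_t (X t * Y t)%:E = (\int[P]_t (X t)%:E) * \int[P]_t (Y t)%:E)%E.
  transitivity (\int[distribution P XY']_z f z)%E.
    by rewrite integral_distribution.
  rewrite (eq_measure_integral (distribution P X' \x distribution P Y')%E); last first.
    by move=> A mA _; exact/esym/joint.
  rewrite -integral12_prod_meas1// /fubini_F/=.
  have iYd : (distribution P Y').-integrable setT EFin.
    apply: integrable_pushforward => //; exact: measurable_EFinP.
  have iXd : (distribution P X').-integrable setT EFin.
    apply: integrable_pushforward => //; exact: measurable_EFinP.
  have EY : (\int[distribution P Y']_y y%:E = \int[P]_t (Y t)%:E)%E.
    by rewrite integral_distribution.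
  have EX : (\int[distribution P X']_y y%:E = \int[P]_t (X t)%:E)%E.
    by rewrite integral_distribution.
  under eq_integral => x _.
    rewrite /f/=; under eq_integral do rewrite EFinM.
    rewrite integralZl// EY -(fineK (integrable_fin_num measurableT iY)).
    over.
  by rewrite integralZr// EX fineK// integrable_fin_num.
rewrite /Rintegral E1 fineM//; exact: integrable_fin_num.
Qed.


(** * Sigma-algebras generated by part of the environment *)

Section past.
Context {d : measure_display} {T : measurableType d} {R : realType}.
Context {P : probability T R} {I : choiceType}.
Variable Y : I -> {RV P >-> R}.

(* A pi-system generating the sigma-algebra of the variables with index in J. *)
Definition rectangles (J : set I) : set (set T) :=
  [set B | exists (s : seq I) (A : I -> set R),
    [/\ [set` s] `<=` J, forall i, measurable (A i) &
        B = \bigcap_(i in [set` s]) (Y i @^-1` A i)]].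

(** The carrier is still [T]; casting a set or a function to [past J] and asking for measurability
    says that it depends only on the variables indexed by [J]. *)
Definition past (J : set I) := g_sigma_algebraType (rectangles J).

Lemma rectangles_measurable J : rectangles J `<=` measurable.
Proof.
move=> B [s [A [_ mA ->]]]; apply: fin_bigcap_measurable => // i _.
by rewrite -[X in measurable X]setTI; exact: measurable_funPT.
Qed.

Lemma setI_closed_rectangles J : setI_closed (rectangles J).
Proof.
move=> _ _ [s [A [sJ mA ->]]] [s' [A' [sJ' mA' ->]]].
exists (s ++ s').
exists (fun i => (if i \in s then A i else setT) `&`
                 (if i \in s' then A' i else setT)); split.
- by move=> i /=; rewrite mem_cat => /orP[/sJ|/sJ'].
- by move=> i; apply: measurableI; case: ifP.
- apply/seteqP; split => t /=.
    move=> [tA tA'] i _; split => /=.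
      by case: ifP => // /tA.
    by case: ifP => // /tA'.
  move=> tAA; split=> i /= si.
    have [] : (Y i @^-1` ((if i \in s then A i else [set: R]) `&`
                          (if i \in s' then A' i else setT))) t.
      by apply: tAA; rewrite /= mem_cat si.
    by rewrite si.
  have [] : (Y i @^-1` ((if i \in s then A i else [set: R]) `&`
                        (if i \in s' then A' i else setT))) t.
    by apply: tAA; rewrite /= mem_cat si orbT.
  by rewrite si.
Qed.

Lemma past_measurable J (A : set T) :
  measurable (A : set (past J)) -> measurable A.
Proof.
by apply: smallest_sub; [exact: sigma_algebra_measurable|exact: rectangles_measurable].
Qed.

Lemma sub_past J J' (A : set T) : J `<=` J' ->
  measurable (A : set (past J)) -> measurable (A : set (past J')).
Proof.
move=> JJ'; apply: sub_sigma_algebra2 => B [s [C [sJ mC ->]]].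
by exists s, C; split => //; exact: subset_trans JJ'.
Qed.

Lemma measurable_past J i : J i -> measurable_fun setT (Y i : past J -> R).
Proof.
move=> Ji _ A mA; rewrite setTI; apply: sub_sigma_algebra.
exists [:: i], (fun=> A); split => //.
  by move=> j /=; rewrite inE => /eqP ->.
apply/seteqP; split => t /= => [tA j /=|]; last by apply; rewrite /= inE.
by rewrite inE => /eqP ->.
Qed.

(** As functions of [A], both sides are finite measures, a restriction and a multiple of [P]. By
    independence they agree on the pi-system [rectangles J], so they agree on the sigma-algebra it
    generates. *)
Lemma past_indep J j (A : set T) (B : set R) :
  mutually_independent Y -> ~ J j ->
  measurable (A : set (past J)) -> measurable B ->
  P (A `&` Y j @^-1` B) = (P A * P (Y j @^-1` B))%E.
Proof.
move=> indY Jj mA mB.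
have mC : measurable (Y j @^-1` B).
  by rewrite -[X in measurable X]setTI; exact: measurable_funPT.
have PC0 : 0 <= fine (P (Y j @^-1` B)) by exact: fine_ge0.
rewrite muleC.
have mscaleE D : mscale (NngNum PC0) P D = (P (Y j @^-1` B) * P D)%E.
  by rewrite /mscale/= fineK ?fin_num_measure.
rewrite -mscaleE -[LHS]/(mrestr P mC A).
apply: (@g_sigma_algebra_measure_unique _ R T (rectangles J)
  (@rectangles_measurable J) (fun=> setT)) => //.
- by move=> _; exists [::], (fun=> setT); split => //; rewrite set_nil bigcap_set0.
- by rewrite bigcup_const//; exists 0%N.
- exact: setI_closed_rectangles.
- move=> _ [s [C [sJ mC' ->]]]; rewrite /= mscaleE /mrestr.
  pose D i := if i == j then B else C i.
  have mD i : measurable (D i) by rewrite /D; case: eqP.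
  (* Mutual independence is stated for duplicate-free lists, so it is applied to [undup s] and to
     [j :: undup s]. *)
  have jus : j \notin undup s.
    by rewrite mem_undup; apply/negP => /sJ.
  have := indY (j :: undup s) D; rewrite /= jus undup_uniq => /(_ isT mD).
  have := indY (undup s) D (undup_uniq s) mD.
  rewrite big_cons => <-.
  rewrite [D j]/D eqxx.
  have e1 : \bigcap_(i in [set` undup s]) (Y i @^-1` D i) =
      \bigcap_(i in [set` s]) (Y i @^-1` C i).
    apply/seteqP; split => t tD i /= si.
      have := tD i; rewrite /= mem_undup /D => /(_ si).
      by case: eqP => // ij _; case: Jj; rewrite -ij; apply: sJ.
    rewrite mem_undup in si.
    have := tD i si; rewrite /D; case: eqP => // ij _.
    by case: Jj; rewrite -ij; apply: sJ.
  rewrite e1 => <-; congr (P _); rewrite -e1.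
  apply/seteqP; split => t /=.
    move=> [tD tB] i /=; rewrite inE => /orP[/eqP ->|]; first by rewrite /D eqxx.
    exact: tD.
  move=> tD; split; last first.
    by have := tD j; rewrite /= inE eqxx /D eqxx; apply.
  by move=> i /= si; apply: tD; rewrite /= inE si orbT.
- by move=> _; rewrite /= /mrestr setTI -ge0_fin_numE// fin_num_measure.
Qed.

(** Boundedness makes every integral below finite and the class stable under products. *)
Definition bpast J (Z : T -> R) :=
  measurable_fun setT (Z : past J -> R) /\ exists c, forall t, `|Z t| <= c.

Lemma bpast_integrable J Z : bpast J Z -> P.-integrable setT (EFin \o Z).
Proof.
move=> [mZ [c Zc]]; apply: (bounded_integrable P Z c) => // _ A mA.
by apply: (@past_measurable J); exact: mZ.
Qed.

Lemma sub_bpast J J' Z : J `<=` J' -> bpast J Z -> bpast J' Z.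
Proof.
move=> JJ' [mZ Zc]; split => // _ A mA.
by apply: (@sub_past J J') => //; exact: mZ.
Qed.

Lemma bpast_cst J r : bpast J (fun=> r).
Proof. by split; [exact: measurable_cst|exists `|r|]. Qed.

Lemma bpastD J Z Z' : bpast J Z -> bpast J Z' -> bpast J (fun t => Z t + Z' t).
Proof.
move=> [mZ [c Zc]] [mZ' [c' Zc']]; split; first exact: measurable_funD.
by exists (c + c') => t; rewrite (le_trans (ler_normD _ _))// lerD.
Qed.

Lemma bpastM J Z Z' : bpast J Z -> bpast J Z' -> bpast J (fun t => Z t * Z' t).
Proof.
move=> [mZ [c Zc]] [mZ' [c' Zc']]; split; first exact: measurable_funM.
by exists (c * c') => t; rewrite normrM ler_pM.
Qed.

Lemma bpast_indic J A : measurable (A : set (past J)) -> bpast J \1_A.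
Proof.
move=> mA; split; first exact: (@measurable_indic _ (past J)).
by exists 1 => t; rewrite indicE; case: (_ \in _); rewrite ?normr1 ?normr0.
Qed.

Lemma bpast_comp J i (f : R -> R) c : J i -> measurable_fun setT f ->
  (forall x, `|f x| <= c) -> bpast J (fun t => f (Y i t)).
Proof.
move=> Ji mf fc; split; last by exists c => t.
by apply: measurableT_comp => //; exact: measurable_past.
Qed.

Lemma bpast_indep J Z j (f : R -> R) c : mutually_independent Y -> ~ J j ->
  bpast J Z -> measurable_fun setT f -> (forall x, `|f x| <= c) ->
  \int[P]_t (Z t * f (Y j t)) = (\int[P]_t Z t) * \int[P]_t f (Y j t).
Proof.
move=> indY Jj [mZ [a Za]] mf fc.
apply: (@expectation_prod_indep _ _ _ P _ _ a c) => //.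
- by move=> _ A mA; apply: (@past_measurable J); exact: mZ.
- exact: measurableT_comp.
- move=> A B mA mB; rewrite -[(fun t => f (Y j t)) @^-1` B]/(Y j @^-1` (f @^-1` B)).
  apply: past_indep Jj _ _ => //.
    by rewrite -[X in measurable X]setTI; exact: mZ.
  by rewrite -[X in measurable X]setTI; exact: mf.
Qed.

(** * Reaching a high level before a low one, given the past *)

Section hitting.
Variables (f : R -> R) (c v : R) (J : set I) (idx : nat -> I).
Hypothesis indY : mutually_independent Y.
Hypothesis mf : measurable_fun setT f.
Hypothesis fc : forall x, `|f x| <= c.
Hypothesis f_mean : forall i, \int[P]_t f (Y i t) = 0.
Hypothesis f_var : forall i, \int[P]_t (f (Y i t) ^+ 2) = v.
Hypothesis v_gt0 : 0 < v.

(** [J] is the part of the environment revealed before the walk starts; step [n] then reads the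
    variable [idx n], which [fresh] places outside everything seen so far. *)
Definition seen n : set I := J `|` [set idx k | k in [set k | (k < n)%N]].

Hypothesis fresh : forall n, ~ seen n (idx n).

Definition partial_sum n t := \sum_(k < n) f (Y (idx k) t).
Local Notation W := partial_sum.

Lemma seenS m n : (m <= n)%N -> seen m `<=` seen n.
Proof.
move=> mn; apply: setUS => _ [k /= km <-]; exists k => //=.
exact: leq_trans mn.
Qed.

Lemma bpast_partial_sum m n : (m <= n)%N -> bpast (seen n) (W m).
Proof.
elim: m => [|m IH] mn.
  rewrite (_ : W 0 = fun=> 0); first exact: bpast_cst.
  by apply/funext => t; rewrite /partial_sum big_ord0.
rewrite (_ : W m.+1 = fun t => W m t + f (Y (idx m) t)); last first.
  by apply/funext => t; rewrite /partial_sum big_ord_recr.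
apply: bpastD; first exact/IH/ltnW.
by apply: (@bpast_comp _ _ f c) => //; right; exists m.
Qed.

Variables (a H : R).
Hypotheses (a_gt0 : 0 < a) (H_gt0 : 0 < H) (c_ge0 : 0 <= c).

Definition above m : set T := [set t | - a < W m t].
Definition reached m : set T := [set t | H <= W m t].
Definition inside n : set T :=
  \bigcap_(k in [set k | (k <= n)%N]) (above k `&` ~` reached k).
Definition up n : set T :=
  \bigcup_(m in [set m | (m <= n)%N])
    (reached m `&` \bigcap_(k in [set k | (k <= m)%N]) above k).

Lemma measurable_above m n : (m <= n)%N ->
  measurable (above m : set (past (seen n))).
Proof.
move=> /bpast_partial_sum[mW _]; rewrite -[X in measurable X]setTI.
have -> : above m = W m @^-1` `]- a, +oo[%classic.
  by apply/seteqP; split => t /=; rewrite in_itv/= andbT.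
exact: mW.
Qed.

Lemma measurable_reached m n : (m <= n)%N ->
  measurable (reached m : set (past (seen n))).
Proof.
move=> /bpast_partial_sum[mW _]; rewrite -[X in measurable X]setTI.
have -> : reached m = W m @^-1` `[H, +oo[%classic.
  by apply/seteqP; split => t /=; rewrite in_itv/= andbT.
exact: mW.
Qed.

Lemma measurable_inside n : measurable (inside n : set (past (seen n))).
Proof.
apply: (@bigcap_measurable _ (past (seen n))); first by exists 0%N.
move=> k /= kn; apply: measurableI; first exact: measurable_above.
by apply: measurableC; exact: measurable_reached.
Qed.

Lemma measurable_up n : measurable (up n : set (past (seen n))).
Proof.
apply: (@bigcup_measurable _ (past (seen n))) => m /= mn.
apply: measurableI; first exact: measurable_reached.
apply: bigcap_measurable; first by exists 0%N.
by move=> k /= km; apply: measurable_above; exact: leq_trans mn.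
Qed.

Variables (M : nat) (A : set T).
Hypothesis M_gt0 : (0 < M)%N.
Hypothesis mA : measurable (A : set (past J)).

(** A step has size at most [c], so a walk that has just left []-a, H[] still satisfies
    [w + a <= width] and [|w| <= width]. *)
Definition width := H + a + c.
Local Notation D := width.
(* Evaluated along the walk it is a martingale.  It is at most 1 on leaving
   ]-a, H[ upwards, and at most 0 on leaving downwards or at time M. *)
Definition barrier n w := (w + a) / D - (D ^+ 2 - w ^+ 2 + v * n%:R) / (v * M%:R).
Local Notation G := barrier.

Lemma width_gt0 : 0 < D.
Proof. by rewrite /width ltr_wpDr// addr_gt0. Qed.

Lemma varM_gt0 : 0 < v * M%:R.
Proof. by rewrite mulr_gt0 ?ltr0n. Qed.
Hint Resolve width_gt0 varM_gt0 : core.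

(** The increment is a multiple of [x] plus a multiple of [x ^+ 2 - v]; both have mean zero when [x]
    is a fresh step. *)
Lemma barrier_step n w x :
  G n.+1 (w + x) = G n w + x * (1 / D + 2 * w / (v * M%:R)) +
    (x ^+ 2 - v) / (v * M%:R).
Proof.
rewrite /barrier -natr1; field.
by rewrite !gt_eqF// ltr0n.
Qed.

Lemma bpast_base n : bpast (seen n) \1_A.
Proof.
by apply: bpast_indic; apply: (@sub_past J) mA => i Ji; left.
Qed.

Lemma bpast_inside n : bpast (seen n) (fun t => \1_A t * \1_(inside n) t).
Proof.
apply: bpastM; first exact: bpast_base.
by apply: bpast_indic; exact: measurable_inside.
Qed.

Lemma bpast_barrier n k : bpast (seen n) (fun t => G k (W n t)).
Proof.
have mW : bpast (seen n) (W n) by exact: bpast_partial_sum.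
rewrite (_ : (fun t => G k (W n t)) = (fun t => (W n t + a) * D^-1 +
  (W n t * W n t * (v * M%:R)^-1 + (- (D ^+ 2 + v * k%:R) / (v * M%:R))))).
  apply: bpastD; last apply: bpastD; last exact: bpast_cst.
    by apply: bpastM; [apply: bpastD => //|]; exact: bpast_cst.
  by apply: bpastM; [exact: bpastM|exact: bpast_cst].
by apply/funext => t; rewrite /barrier; field; rewrite !gt_eqF// ltr0n.
Qed.

(** By [barrier_step], the difference of the integrands consists of bounded functions of the past
    times [x] or [x ^+ 2 - v]. The step is independent of the past, so these terms integrate to
    0. *)
Lemma barrier_martingale n :
  \int[P]_t (\1_A t * \1_(inside n) t * G n.+1 (W n.+1 t)) =
  \int[P]_t (\1_A t * \1_(inside n) t * G n (W n t)).
Proof.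
pose Z t : R := \1_A t * \1_(inside n) t.
have bZ : bpast (seen n) Z := bpast_inside n.
pose U t := Z t * (1 / D + 2 / (v * M%:R) * W n t).
have bU : bpast (seen n) U.
  apply: bpastM => //; apply: bpastD; first exact: bpast_cst.
  by apply: bpastM; [exact: bpast_cst|exact: bpast_partial_sum].
pose x t := f (Y (idx n) t).
have bx : bpast (seen n.+1) x.
  by apply: (@bpast_comp _ _ f c) => //; right; exists n => /=.
have bS Z' : bpast (seen n) Z' -> bpast (seen n.+1) Z'.
  by apply: sub_bpast; exact: seenS.
under eq_Rintegral => t _.
  have -> : \1_A t * \1_(inside n) t * G n.+1 (W n.+1 t) =
     \1_A t * \1_(inside n) t * G n (W n t) + (U t * x t +
       ((v * M%:R)^-1 * (Z t * (x t ^+ 2)) + (- M%:R^-1) * Z t)).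
    rewrite /partial_sum big_ord_recr/= -/(partial_sum n t) -/(x t).
    rewrite barrier_step -/(Z t) /U; field.
    by rewrite !gt_eqF// ltr0n.
  over.
have iZ := bpast_integrable _ _ bZ.
have bZx2 : bpast (seen n.+1) (fun t => Z t * (x t ^+ 2)).
  by apply: bpastM; [exact: bS|exact: (bpastM _ _ _ bx bx)].
have bUx : bpast (seen n.+1) (fun t => U t * x t) by apply: bpastM; [exact: bS|].
have b1 r Z' : bpast (seen n.+1) Z' -> bpast (seen n.+1) (fun t => r * Z' t).
  by move=> ?; apply: bpastM => //; exact: bpast_cst.
have bZ1 := bS _ bZ.
have bZG : bpast (seen n.+1) (fun t => \1_A t * \1_(inside n) t * G n (W n t)).
  by apply/bS/bpastM => //; exact: bpast_barrier.
have b2 := bpastD _ _ _ (b1 (v * M%:R)^-1 _ bZx2) (b1 (- M%:R^-1) _ bZ1).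
have b3 := bpastD _ _ _ bUx b2.
rewrite RintegralD//; [|exact: bpast_integrable bZG|exact: bpast_integrable b3].
rewrite RintegralD//; [|exact: bpast_integrable bUx|exact: bpast_integrable b2].
rewrite RintegralD//; [|exact: bpast_integrable (b1 _ _ bZx2)|
  exact: bpast_integrable (b1 _ _ bZ1)].
rewrite RintegralZl//; last exact: bpast_integrable bZx2.
rewrite RintegralZl//.
have -> : \int[P]_t (U t * x t) = 0.
  by rewrite (bpast_indep (seen n) U (idx n) f c)// f_mean mulr0.
have -> : \int[P]_t (Z t * x t ^+ 2) = (\int[P]_t Z t) * v.
  rewrite (bpast_indep (seen n) Z (idx n) (fun y => f y ^+ 2) (c ^+ 2))// ?f_var//.
    exact: measurable_funX.
  by move=> y; rewrite normrX lerXn2r ?nnegrE.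
rewrite add0r [X in _ + X](_ : _ = 0) ?addr0//; field.
by rewrite !gt_eqF// ltr0n.
Qed.

Lemma barrier_le0 n w : - (a + c) <= w <= - a -> G n w <= 0.
Proof.
have [a0 H0 c0] := And3 a_gt0 H_gt0 c_ge0.
move=> /andP[w1 w2]; rewrite /barrier subr_le0 (@le_trans _ _ 0)//.
  by rewrite mulr_le0_ge0 ?invr_ge0 ?(ltW width_gt0)//; lra.
rewrite divr_ge0 ?(ltW varM_gt0)// addr_ge0 ?mulr_ge0 ?(ltW v_gt0)//.
by rewrite /width; nra.
Qed.

Lemma barrier_le1 n w : - a <= w <= H + c -> G n w <= 1.
Proof.
have [a0 H0 c0] := And3 a_gt0 H_gt0 c_ge0.
move=> /andP[w1 w2]; rewrite /barrier lerBlDr ler_wpDr//.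
  rewrite divr_ge0 ?(ltW varM_gt0)// addr_ge0 ?mulr_ge0 ?(ltW v_gt0)//.
  by rewrite /width; nra.
by rewrite ler_pdivrMr// mul1r /width; lra.
Qed.

Lemma barrier_end w : - a <= w <= H -> G M w <= 0.
Proof.
have [a0 H0 c0] := And3 a_gt0 H_gt0 c_ge0.
move=> /andP[w1 w2]; rewrite /barrier subr_le0 (@le_trans _ _ 1)//.
  by rewrite ler_pdivrMr// mul1r /width; lra.
rewrite ler_pdivlMr// mul1r lerDr /width; nra.
Qed.

Lemma partial_sumS n t : W n.+1 t = W n t + f (Y (idx n) t).
Proof. by rewrite /partial_sum big_ord_recr. Qed.

(** A path leaving downwards at this step has barrier at most 0. One leaving upwards has barrier at
    most 1, paid for by the increment of the indicator of [up]. For a path that left earlier, the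
    monotonicity of [up] is enough. *)
Lemma barrier_indic_step n t :
  \1_(inside n) t * G n.+1 (W n.+1 t) <=
  \1_(inside n.+1) t * G n.+1 (W n.+1 t) + (\1_(up n.+1) t - \1_(up n) t).
Proof.
have [a0 H0 c0] := And3 a_gt0 H_gt0 c_ge0.
have upS : up n t -> up n.+1 t by move=> [m /= mn Hm]; exists m => //=; exact: leqW.
have inS : inside n.+1 t -> inside n t by move=> + k /= kn; apply => /=; exact: leqW.
rewrite !indicE.
have [tn|tn] := boolP (t \in inside n); last first.
  have /negbTE -> : t \notin inside n.+1.
    by apply: contra tn; rewrite !inE.
  rewrite !mul0r add0r subr_ge0 ler_nat.
  have [tu|//] := boolP (t \in up n).
  by rewrite (_ : (t \in up n.+1) = true)//; apply/mem_set/upS/set_mem.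
rewrite inE in tn.
have /negbTE -> : t \notin up n.
  apply/negP; rewrite inE => -[m /= mn [Hm _]].
  by have [_ /(_ Hm)] := tn m mn.
rewrite subr0 mul1r.
have [an rn] := tn n (leqnn n); move/negP in rn; rewrite -ltNge in rn.
have := fc (Y (idx n) t); rewrite ler_norml => /andP[f1 f2].
have WS := partial_sumS n t; rewrite /above/= in an.
have [Wa|Wa] := leP (W n.+1 t) (- a).
  rewrite (_ : (t \in inside n.+1) = false).
    rewrite mul0r add0r (@le_trans _ _ 0)// barrier_le0//.
    by apply/andP; split => //; lra.
  apply/negbTE/negP; rewrite inE => /(_ n.+1 (leqnn _))[].
  by rewrite /above/= ltNge Wa.
have [WH|WH] := leP H (W n.+1 t).
  rewrite (_ : (t \in inside n.+1) = false).
    rewrite mul0r add0r (_ : (t \in up n.+1) = true).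
      by rewrite barrier_le1//; apply/andP; split; lra.
    apply/mem_set; exists n.+1 => //=; split => // k /=.
    by rewrite leq_eqVlt => /predU1P[->//|kn]; have [] := tn k kn.
  by apply/negbTE/negP; rewrite inE => /(_ n.+1 (leqnn _))[_]; apply.
rewrite (_ : (t \in inside n.+1) = true) ?mul1r ?lerDl ?ler0n//.
apply/mem_set => k /=; rewrite leq_eqVlt => /predU1P[->|kn]; last exact: tn.
by split => //; apply/negP; rewrite -ltNge.
Qed.

(** Optional stopping without a stopping time: the stopped barrier is split into the paths still
    inside and those that have left, which contribute at most the indicator of [up n]. *)
Lemma hitting_induction n :
  G 0 0 * \int[P]_t \1_A t <= \int[P]_t (\1_A t * \1_(up n) t) +
    \int[P]_t (\1_A t * \1_(inside n) t * G n (W n t)).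
Proof.
have bA := bpast_base.
have bAu m : bpast (seen m) (fun t => \1_A t * \1_(up m) t).
  by apply: bpastM => //; apply: bpast_indic; exact: measurable_up.
have bS m Z' : bpast (seen m) Z' -> bpast (seen m.+1) Z'.
  by apply: sub_bpast; exact: seenS.
elim: n => [|n IH].
  rewrite -RintegralZl//; last exact: bpast_integrable (bA 0%N).
  rewrite -RintegralD//; [|exact: bpast_integrable (bAu 0%N)|]; last first.
    by apply/bpast_integrable/bpastM; [exact: bpast_inside|exact: bpast_barrier].
  apply: le_Rintegral => //.
  - apply/bpast_integrable/bpastM; [exact: bpast_cst|exact: (bA 0%N)].
  - apply/bpast_integrable/bpastD; first exact: (bAu 0%N).
    by apply: bpastM; [exact: bpast_inside|exact: bpast_barrier].
  - move=> t _; have -> : W 0 t = 0 by rewrite /partial_sum big_ord0.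
    rewrite [\1_(inside 0) t]indicE mem_set ?mulr1; last first.
      move=> k /=; rewrite leqn0 => /eqP ->.
      rewrite /above /reached /= /partial_sum big_ord0.
      by split; [rewrite oppr_lt0|apply/negP; rewrite -ltNge].
    by rewrite mulrC lerDr mulr_ge0 ?indicE ?ler0n.
apply: (le_trans IH); rewrite -barrier_martingale.
have bG m : bpast (seen m) (fun t => \1_A t * \1_(inside m) t * G m (W m t)).
  by apply: bpastM; [exact: bpast_inside|exact: bpast_barrier].
have bG' : bpast (seen n.+1)
    (fun t => \1_A t * \1_(inside n) t * G n.+1 (W n.+1 t)).
  by apply: bpastM; [exact/bS/bpast_inside|exact: bpast_barrier].
rewrite -RintegralD//; [|exact: bpast_integrable (bAu n)|
  exact: bpast_integrable bG'].
rewrite -RintegralD//; [|exact: bpast_integrable (bAu n.+1)|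
  exact: bpast_integrable (bG n.+1)].
apply: le_Rintegral => //.
- apply/bpast_integrable/(bpastD (seen n.+1)); [exact/bS/bAu|exact: bG'].
- by apply/bpast_integrable/(bpastD (seen n.+1)); [exact/bAu|exact: bG].
- move=> t _; rewrite -!mulrA -!mulrDr ler_wpM2l ?indicE ?ler0n//.
  by have := barrier_indic_step n t; rewrite !indicE; lra.
Qed.

Lemma hitting :
  ((a / D - D ^+ 2 / (v * M%:R))%:E * P A <= P (A `&` up M))%E.
Proof.
have [a0 H0] := conj a_gt0 H_gt0.
have mAT : measurable A := past_measurable _ _ mA.
have mupT : measurable (up M) := past_measurable _ _ (measurable_up M).
have PE B : measurable B -> \int[P]_t (\1_B t : R) = fine (P B).
  by move=> mB; rewrite /Rintegral integral_indic// setIT.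
have -> : a / D - D ^+ 2 / (v * M%:R) = G 0 0.
  by rewrite /barrier add0r expr0n/= mulr0 subr0 addr0.
rewrite -(fineK (fin_num_measure P A mAT)).
rewrite -(fineK (fin_num_measure P _ (measurableI _ _ mAT mupT))).
rewrite -EFinM lee_fin -!PE//; last exact: measurableI.
have -> : \int[P]_t (\1_(A `&` up M) t : R) = \int[P]_t (\1_A t * \1_(up M) t).
  by apply: eq_Rintegral => t _; rewrite indicI.
apply: (le_trans (hitting_induction M)).
(* The paths still inside at time [M] contribute a nonpositive term, by [barrier_end]. *)
rewrite gerDl -oppr_ge0 -mulN1r -RintegralZl//; last first.
  apply: (@bpast_integrable (seen M)).
  by apply: bpastM; [exact: bpast_inside|exact: bpast_barrier].
apply: Rintegral_ge0 => t _; rewrite mulN1r oppr_ge0 -mulrA.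
rewrite [\1_A t]indicE mulr_ge0_le0 ?ler0n// indicE.
have [tn|_] := boolP (t \in inside M); last by rewrite mul0r.
rewrite inE in tn; have [an rn] := tn M (leqnn M).
move/negP in rn; rewrite -ltNge in rn; rewrite mul1r barrier_end//.
by rewrite !ltW.
Qed.

End hitting.
End past.

(** * Valleys of the potential *)

Lemma nat_ge {R : realType} (x : R) : exists n : nat, x <= n%:R.
Proof. by exists (Num.truncn x).+1; exact/ltW/truncnS_gt. Qed.

Lemma square_cube_leq (N B h : nat) : (0 < B)%N -> (B + N <= h)%N ->
  (N + B * h ^ 2 <= h ^ 3)%N.
Proof.
move=> B0 BNh; apply: (@leq_trans ((B + N) * h ^ 2)).
  rewrite mulnDl addnC leq_add2l leq_pmulr// expn_gt0.
  by rewrite (leq_trans _ BNh)// addn_gt0 B0.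
by rewrite expnS leq_mul2r BNh orbT.
Qed.

Section valley_side.
Context {d : measure_display} {T : measurableType d} {R : realType}.
Context {P : probability T R} {I : choiceType}.
Variables (Y : I -> {RV P >-> R}) (f : R -> R) (idx : nat -> I) (delta : R).

(** The height [h] is reached on the diffusive scale [h ^ 2]; allowing [h ^ 3] steps absorbs any
    constant factor and any fixed number of sites seen before, at a polynomial cost only. *)
Definition valley_side (h : nat) : set T :=
  \bigcup_(n in [set n | (n <= h ^ 3)%N])
    ([set t | h%:R <= partial_sum Y f idx n t] `&`
     \bigcap_(k in [set k | (k <= n)%N])
       [set t | - (delta * h%:R) <= partial_sum Y f idx k t]).

Lemma measurable_valley_side c (J : set I) h :
  measurable_fun setT f -> (forall x, `|f x| <= c) ->
  (forall k, (k < h ^ 3)%N -> J (idx k)) ->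
  measurable (valley_side h : set (past Y J)).
Proof.
move=> mf fc Jidx.
have mW n : (n <= h ^ 3)%N ->
    measurable_fun setT (partial_sum Y f idx n : past Y J -> R).
  move=> nh; suff : bpast Y J (partial_sum Y f idx n) by case.
  apply: sub_bpast (bpast_partial_sum Y f c J idx mf fc n n (leqnn n)).
  by move=> i [//|[k /= kn <-]]; apply: Jidx; exact: leq_trans nh.
have mge n r : (n <= h ^ 3)%N ->
    measurable ([set t | r <= partial_sum Y f idx n t] : set (past Y J)).
  move=> nh; rewrite -[X in measurable X]setTI.
  have -> : [set t | r <= partial_sum Y f idx n t] =
      partial_sum Y f idx n @^-1` `[r, +oo[%classic.
    by apply/seteqP; split => t /=; rewrite in_itv/= andbT.
  exact: mW.
apply: (@bigcup_measurable _ (past Y J)) => n /= nh.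
apply: measurableI; first exact: mge.
apply: bigcap_measurable; first by exists 0%N.
by move=> k /= kn; apply: mge; exact: leq_trans nh.
Qed.

Variables (c v : R) (J : set I) (A : set T) (N B h : nat).
Hypothesis indY : mutually_independent Y.
Hypothesis mf : measurable_fun setT f.
Hypothesis fc : forall x, `|f x| <= c.
Hypothesis f_mean : forall i, \int[P]_t f (Y i t) = 0.
Hypothesis f_var : forall i, \int[P]_t (f (Y i t) ^+ 2) = v.
Hypothesis v_gt0 : 0 < v.
Hypothesis c_ge0 : 0 <= c.
Hypothesis delta01 : 0 < delta <= 1.
Hypothesis fresh : forall k, (N <= k)%N -> ~ J (idx k).
Hypothesis idx_inj : injective idx.
Hypothesis mA : measurable (A : set (past Y J)).
Hypothesis B_gt : 256 / (v * delta) <= B%:R.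
Hypothesis B_gt0 : (0 < B)%N.
Hypothesis h_gt : (B + N <= h)%N.
Hypothesis h_c : c <= h%:R.
Hypothesis h_N : c * N%:R <= delta * h%:R / 2.

Lemma partial_sum_bound n t : `|partial_sum Y f idx n t| <= c * n%:R.
Proof.
apply: (le_trans (ler_norm_sum _ _ _)).
apply: (@le_trans _ _ (\sum_(k < n) c)); first by apply: ler_sum => k _; exact: fc.
by rewrite sumr_const card_ord mulr_natr.
Qed.

Lemma partial_sum_shift n t : partial_sum Y f idx (N + n) t =
  partial_sum Y f idx N t + partial_sum Y f (fun k => idx (N + k)) n t.
Proof. by rewrite /partial_sum big_split_ord. Qed.

Lemma valley_side_prob :
  ((delta / 16)%:E * P A <= P (A `&` valley_side h))%E.
Proof.
have /andP[d0 d1] := delta01; have [c0 v0 hc hN] := And4 c_ge0 v_gt0 h_c h_N.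
(* Half of the allowed depth and a surplus [h] of height are kept in reserve for the first [N]
   steps: their sites may have been seen already, and they move the walk by at most
   [c * N <= delta * h / 2]. *)
pose M := (B * h ^ 2)%N; pose a := delta * h%:R / 2; pose H := 2 * h%:R : R.
have h1 : (1 <= h)%N by rewrite (leq_trans _ h_gt)// addn_gt0 B_gt0.
have h1R : 1 <= h%:R :> R by rewrite ler1n.
have a_gt0 : 0 < a by rewrite /a; nra.
have H_gt0 : 0 < H by rewrite /H; nra.
have M_gt0 : (0 < M)%N by rewrite /M muln_gt0 B_gt0 expn_gt0 h1.
have MN : (N + M <= h ^ 3)%N by exact: square_cube_leq.
have frs n : ~ seen J (fun k => idx (N + k)) n (idx (N + n)).
  move=> [|[k /= kn /idx_inj /addnI kE]]; first by apply: fresh; exact: leq_addr.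
  by move: kn; rewrite kE ltnn.
have mAT : measurable A := past_measurable Y J A mA.
have mup : measurable (up Y f (fun k => idx (N + k)) a H M).
  exact: (past_measurable Y _ _ (measurable_up Y f c J _ mf fc a H M)).
have mvs : measurable (valley_side h).
  by apply: (past_measurable Y setT); exact: (measurable_valley_side c).
have hit := hitting Y f c v J _ indY mf fc f_mean f_var v_gt0 frs a H
  a_gt0 H_gt0 c_ge0 M A M_gt0 mA.
have sub : A `&` up Y f (fun k => idx (N + k)) a H M `<=` A `&` valley_side h.
  move=> t [At [n /= nM [Hn an]]]; split => //; exists (N + n)%N.
    by rewrite /= (leq_trans _ MN)// leq_add2l.
  have := partial_sum_bound N t; rewrite ler_norml => /andP[b1 b2].
  split => [|k /= kn].
    rewrite /= partial_sum_shift.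
    have : H <= partial_sum Y f (fun k => idx (N + k)) n t by [].
    by rewrite /H; nra.
  have [kN|kN] := leqP k N.
    have := partial_sum_bound k t; rewrite ler_norml => /andP[b3 b4].
    have kNR : k%:R <= N%:R :> R by rewrite ler_nat.
    nra.
  have := an (k - N)%N; rewrite /= leq_subLR => /(_ kn).
  rewrite /above/= -{2}(subnKC (ltnW kN)) partial_sum_shift /a; nra.
apply: (@le_trans _ _ (P (A `&` up Y f (fun k => idx (N + k)) a H M))).
  apply: le_trans hit; rewrite lee_wpmul2r// lee_fin.
  (* The width is at most [4 * h], so the linear term is at least [delta / 8], while the choice of
     [B] makes the quadratic term at most [16 / (v * B) <= delta / 16]. *)
  have D0 : 0 < width c a H by exact: width_gt0.
  have D4 : width c a H <= 4 * h%:R by rewrite /width /a /H; nra.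
  have p1 : delta / 8 <= a / width c a H.
    by rewrite ler_pdivlMr// /a; nra.
  have p2 : width c a H ^+ 2 / (v * M%:R) <= delta / 16.
    have vM0 : 0 < v * M%:R by rewrite mulr_gt0// ltr0n.
    rewrite ler_pdivrMr// /M natrM natrX.
    have Bv : 256 <= B%:R * (v * delta).
      by rewrite -ler_pdivrMr ?mulr_gt0.
    have : width c a H ^+ 2 <= 16 * h%:R ^+ 2.
      have -> : 16 * h%:R ^+ 2 = (4 * h%:R) ^+ 2 :> R by ring.
      by rewrite lerXn2r ?nnegrE ?mulr_ge0// ltW.
    have : 0 <= h%:R ^+ 2 :> R by exact: sqr_ge0.
    nra.
  lra.
by rewrite le_measure ?inE//; exact: measurableI.
Qed.

End valley_side.

(** The site whose [rho] governs step [k] of the potential: going right from [k] it is [k + 1], and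
    going left from [- k] it is [- k], with the sign of the logarithm reversed. Site 0 thus belongs
    to the left side. *)
Definition right_site (k : nat) : int := k%:Z + 1.
Definition left_site (k : nat) : int := - k%:Z.

(** Half-open because it holds the first [N] sites of each side, [1, ..., N] and
    [0, ..., - N + 1]. *)
Definition window (N : nat) : set int := [set x | - N%:Z < x <= N%:Z].

Lemma right_site_inj : injective right_site.
Proof. by move=> k k'; rewrite /right_site; lia. Qed.

Lemma left_site_inj : injective left_site.
Proof. by move=> k k'; rewrite /left_site; lia. Qed.

Lemma right_site_window (N k : nat) : window N (right_site k) <-> (k < N)%N.
Proof. by rewrite /window /right_site /=; split; lia. Qed.

Lemma left_site_window (N k : nat) : window N (left_site k) <-> (k < N)%N.
Proof. by rewrite /window /left_site /=; split; lia. Qed.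

Lemma right_site_gt (N k : nat) : - N%:Z < right_site k.
Proof. by rewrite /right_site; lia. Qed.

Lemma left_site_gt (N k : nat) : (- N%:Z < left_site k) = (k < N)%N.
Proof. by rewrite /left_site; lia. Qed.

(** * Almost surely there are valleys of arbitrarily large height *)

Section valley.
Context {d : measure_display} {T : measurableType d} {R : realType}.
Context {P : probability T R}.
Variables (Y : int -> {RV P >-> R}) (f : R -> R) (delta c v : R).
Hypothesis indY : mutually_independent Y.
Hypothesis mf : measurable_fun setT f.
Hypothesis fc : forall x, `|f x| <= c.
Hypothesis f_mean : forall i, \int[P]_t f (Y i t) = 0.
Hypothesis f_var : forall i, \int[P]_t (f (Y i t) ^+ 2) = v.
Hypothesis v_gt0 : 0 < v.
Hypothesis c_ge0 : 0 <= c.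
Hypothesis delta01 : 0 < delta <= 1.

Definition valley (h : nat) : set T :=
  valley_side Y f right_site delta h `&`
  valley_side Y (fun x => - f x) left_site delta h.

Definition no_valley (K N : nat) : set T :=
  \bigcap_(h in [set h | (K <= h < N)%N]) ~` valley h.

Let mNf : measurable_fun setT (fun x => - f x).
Proof. exact: measurable_funN. Qed.

Let Nfc x : `|- f x| <= c. Proof. by rewrite normrN. Qed.

Lemma measurable_valley (N h : nat) : (h ^ 3 <= N)%N ->
  measurable (valley h : set (past Y (window N))).
Proof.
move=> hN; apply: measurableI.
  apply: (measurable_valley_side _ _ _ _ c) => // k kh.
  by apply/right_site_window; exact: leq_trans hN.
apply: (measurable_valley_side _ _ _ _ c) => // k kh.
by apply/left_site_window; exact: leq_trans hN.
Qed.

Lemma measurable_no_valley K N :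
  measurable (no_valley K N : set (past Y (window (N ^ 3)))).
Proof.
have [KN|KN] := ltnP K N; last first.
  rewrite (_ : no_valley K N = setT); first exact: measurableT.
  by apply/seteqP; split => // t _ h /= /andP[Kh]; rewrite ltnNge (leq_trans KN).
apply: (@bigcap_measurable _ (past Y (window (N ^ 3)))).
  by exists K; rewrite /= leqnn.
move=> h /= /andP[_ hN]; apply: measurableC; apply: measurable_valley.
by rewrite leq_exp2r// ltnW.
Qed.

(** [valley_side_prob] is used twice: for the right side given [A], then for the left side given [A]
    and the right side, which it can treat as past. *)
Lemma valley_prob (N : nat) : \forall h \near \oo, forall A : set T,
  measurable (A : set (past Y (window N))) ->
  (((delta / 16) ^+ 2)%:E * P A <= P (A `&` valley h))%E.
Proof.
have /andP[d0 d1] := delta01.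
have [B' B'v] := nat_ge (256 / (v * delta)); pose B := B'.+1.
have BR : 256 / (v * delta) <= B%:R by rewrite (le_trans B'v)// ler_nat.
have [n1 cn1] := nat_ge c; have [n2 cn2] := nat_ge (2 * c * N%:R / delta).
exists (B + N + n1 + n2)%N => // h /= hh0 A mA.
have h_B : (B + N <= h)%N by clear -hh0; lia.
have h_c : c <= h%:R by rewrite (le_trans cn1)// ler_nat; clear -hh0; lia.
have h_N : c * N%:R <= delta * h%:R / 2.
  have : 2 * c * N%:R / delta <= h%:R.
    by rewrite (le_trans cn2)// ler_nat; clear -hh0; lia.
  rewrite ler_pdivrMr//; lra.
(* [J] contains the window and the whole right half-line, so it decides [Ar], yet it misses the left
   sites of index at least [N]. *)
pose J := [set x : int | - N%:Z < x].
pose Ar := A `&` valley_side Y f right_site delta h.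
have mAr : measurable (Ar : set (past Y J)).
  apply: measurableI.
    by apply: (@sub_past _ _ _ _ _ Y (window N)) mA => x /= /andP[].
  apply: (measurable_valley_side _ _ _ _ c) => // k kh.
  exact: right_site_gt.
have right : ((delta / 16)%:E * P A <= P Ar)%E.
  apply: (valley_side_prob Y f right_site delta c v (window N) A N B) => //.
  - by move=> k Nk /right_site_window; rewrite ltnNge Nk.
  - exact: right_site_inj.
have left : ((delta / 16)%:E * P Ar <=
    P (Ar `&` valley_side Y (fun x => (- f x)%R) left_site delta h))%E.
  apply: (valley_side_prob Y (fun x => - f x) left_site delta c v J Ar N B) => //.
  - move=> i; rewrite (_ : (fun t => _) = (fun t => -1 * f (Y i t))); last first.
      by apply/funext => t; rewrite mulN1r.
    rewrite RintegralZl// ?f_mean ?mulr0//.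
    apply: (bounded_integrable P _ c) => //; exact: measurableT_comp.
  - by move=> i; rewrite -(f_var i); apply: eq_Rintegral => t _; rewrite sqrrN.
  - by move=> k Nk; rewrite /J /= left_site_gt ltnNge Nk.
  - exact: left_site_inj.
rewrite /valley setIA; apply: le_trans left.
rewrite expr2 EFinM -muleA lee_wpmul2l// lee_fin; lra.
Qed.

(** The absence of valleys of height below [N] is decided in a finite window, so by [valley_prob]
    some larger height removes at least a fraction [q] of this event. *)
Lemma no_valley_null K : P (\bigcap_N no_valley K N) = 0%E.
Proof.
have /andP[d0 d1] := delta01.
have mT N : measurable (no_valley K N).
  exact: past_measurable (measurable_no_valley K N).
have mvT h : measurable (valley h).
  exact: past_measurable (measurable_valley _ h (leqnn _)).
pose p N := fine (P (no_valley K N)).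
pose q := (delta / 16) ^+ 2.
have q01 : 0 < q < 1 by rewrite /q; apply/andP; split; nra.
have p0 N : 0 <= p N by exact: fine_ge0.
have step N : exists N', p N' <= (1 - q) * p N.
  have [h0 _ h0P] := valley_prob (N ^ 3).
  (* Being at least [K] and [N], this height is excluded by [no_valley K h.+1], and that event is
     contained in [no_valley K N]. *)
  pose h := maxn h0 (maxn K N); exists h.+1.
  have := h0P h (leq_maxl _ _) _ (measurable_no_valley K N).
  have mI : measurable (no_valley K N `&` valley h) by exact: measurableI.
  rewrite -(fineK (fin_num_measure P _ (mT N))) -(fineK (fin_num_measure P _ mI)).
  rewrite -EFinM lee_fin -/(p N) -/q => qp.
  have : p h.+1 <= fine (P (no_valley K N `\` valley h)).
    rewrite fine_le ?fin_num_measure//; first exact: measurableD.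
    rewrite le_measure ?inE//; first exact: measurableD.
    move=> t th; split.
      move=> k /= /andP[Kk kN]; apply: th; rewrite /= Kk/= ltnS (leq_trans (ltnW kN))//.
      by rewrite /h !leq_max leqnn !orbT.
    by apply: th; rewrite /= ltnSn andbT /h !leq_max leqnn orbT.
  rewrite measureD// ?fineB ?fin_num_measure//; last first.
    by rewrite -ge0_fin_numE// fin_num_measure.
  rewrite -/(p N); lra.
(* By [step], the infimum satisfies [s <= (1 - q) * s], which forces [s <= 0]. *)
pose s := inf (range p).
have hs : has_inf (range p).
  by split; [exists (p 0%N), 0%N|exists 0 => _ [N _ <-]].
have sp N : s <= p N by apply: ge_inf; [exact: hs.2|exists N].
have s0 : s <= 0.
  have /andP[q0 q1] := q01.
  have : s / (1 - q) <= s.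
    apply: lb_le_inf; first exact: hs.1.
    move=> _ [N _ <-]; have [N' pN'] := step N.
    by rewrite ler_pdivrMr ?subr_gt0// mulrC (le_trans (sp N')).
  rewrite ler_pdivrMr ?subr_gt0//; nra.
have mcap : measurable (\bigcap_N no_valley K N) by exact: bigcapT_measurable.
rewrite -(fineK (fin_num_measure P _ mcap)); congr EFin; apply/eqP.
rewrite eq_le fine_ge0// andbT (le_trans _ s0)//; apply: lb_le_inf; first exact: hs.1.
move=> _ [N _ <-]; rewrite fine_le ?fin_num_measure// le_measure ?inE//.
exact: bigcap_inf.
Qed.

Lemma valley_io : {ae P, forall t, forall K, exists2 h, (K <= h)%N & valley h t}.
Proof.
apply: ae_foralln => K.
exists (\bigcap_N no_valley K N); split.
- apply: bigcapT_measurable => N.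
  exact: past_measurable (measurable_no_valley K N).
- exact: no_valley_null.
- move=> t /= nt N _ h /= /andP[Kh hN] ht; apply: nt.
  by exists h.
Qed.

End valley.

(** * Divergence *)

Definition potential {R : realType} (xi : int -> R) (x : int) : R :=
  match x with
  | Posz n => \sum_(k < n) xi (right_site k)
  | Negz n => \sum_(k < n.+1) - xi (left_site k)
  end.

Lemma potentialS {R : realType} (xi : int -> R) (x : int) :
  potential xi (x + 1) = potential xi x + xi (x + 1).
Proof.
case: x => [n|[|n]].
- have -> : Posz n + 1 = Posz n.+1 by lia.
  by rewrite /= big_ord_recr/= /right_site; congr (_ + xi _); lia.
- have -> : Negz 0 + 1 = 0 by [].
  by rewrite /= big_ord0 big_ord_recr big_ord0/= add0r /left_site oppr0 addNr.
- have -> : Negz n.+1 + 1 = Negz n by lia.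
  rewrite /= [in RHS]big_ord_recr/= /left_site.
  have -> : - n.+1%:Z = Negz n by lia.
  by rewrite subrK.
Qed.

Lemma potentialN {R : realType} (xi : int -> R) (l : nat) :
  potential xi (- l%:Z) = \sum_(k < l) - xi (left_site k).
Proof.
case: l => [|l]; first by rewrite oppr0 /= !big_ord0.
by have -> : - l.+1%:Z = Negz l by lia.
Qed.

(** Since [h ^ 3] is at most a constant times [expR (delta * h)], the power is at least a constant
    times [expR (- (2 * delta * alpha * h))], hence times [expR (- (h / 2))]. The first factor is of
    order [expR h], so the product grows at least like [expR (h / 2)]. *)
Lemma valley_contribution {R : realType} (eps delta alpha B : R) :
  0 < eps -> 0 < delta -> 0 < alpha -> 2 * delta * alpha <= 1 / 2 ->
  exists K : nat, forall h : nat, (K <= h)%N ->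
  B <= (Num.truncn (eps * expR h%:R / 4))%:R *
    (eps * expR (- (delta * h%:R)) / (4 * (2 * h ^ 3).+1%:R)) `^ alpha.
Proof.
move=> eps0 delta0 alpha0 da.
(* From [(delta * h / 3) ^+ 3 <= expR (delta * h)] comes [2 * h ^ 3 <= 54 / delta ^+ 3 * expR (delta
   * h)]; the summand 1 accounts for the successor. *)
pose C1 := 54 / delta ^+ 3 + 1; pose c1 := eps / (4 * C1).
have C10 : 0 < C1 by rewrite /C1 addr_gt0// divr_gt0// exprn_gt0.
have c10 : 0 < c1 by rewrite divr_gt0// mulr_gt0.
pose ca := c1 `^ alpha; have ca0 : 0 < ca by rewrite powR_gt0.
(* Chosen so that [eps * h / 8 >= B / ca + 1], where [expR (h / 2)] is estimated below by
   [1 + h / 2]. *)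
have [K KB] := nat_ge (8 * (B / ca + 1) / eps); exists K => h Kh.
have hB : 8 * (B / ca + 1) / eps <= h%:R by rewrite (le_trans KB)// ler_nat.
have h0 : 0 <= h%:R :> R by [].
pose x := expR (delta * h%:R).
have x1 : 1 <= x.
  by rewrite (le_trans _ (expR_ge1Dx _))// lerDl mulr_ge0// ltW.
have x0 : 0 < x by rewrite expR_gt0.
have hx : h%:R ^+ 3 <= 27 / delta ^+ 3 * x.
  have y0 : 0 <= delta * h%:R / 3 by rewrite divr_ge0// mulr_ge0// ltW.
  have : (delta * h%:R / 3) ^+ 3 <= x.
    have -> : x = expR (delta * h%:R / 3) ^+ 3.
      by rewrite -expRM_natl; congr expR; field.
    rewrite lerXn2r ?nnegrE ?expR_ge0//.
    by rewrite (le_trans _ (expR_ge1Dx _))// lerDr.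
  have -> : h%:R ^+ 3 = 27 / delta ^+ 3 * (delta * h%:R / 3) ^+ 3.
    by field; rewrite gt_eqF.
  by rewrite ler_pM2l// divr_gt0// exprn_gt0.
have N_le : (2 * h ^ 3).+1%:R <= C1 * x.
  have -> : (2 * h ^ 3).+1%:R = 2 * h%:R ^+ 3 + 1 :> R.
    by rewrite -natr1 natrM natrX.
  have -> : C1 * x = 2 * (27 / delta ^+ 3 * x) + x by rewrite /C1; ring.
  lra.
have q_ge : c1 * expR (- (2 * (delta * h%:R))) <=
    eps * expR (- (delta * h%:R)) / (4 * (2 * h ^ 3).+1%:R).
  have -> : expR (- (2 * (delta * h%:R))) = x^-1 * x^-1.
    by rewrite expRN mulr_natl mulr2n expRD invfM.
  have -> : c1 * (x^-1 * x^-1) = eps * x^-1 / (4 * (C1 * x)).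
    by rewrite /c1; field; rewrite !gt_eqF.
  rewrite expRN -/x ler_pM2l ?mulr_gt0 ?invr_gt0//.
  by rewrite lef_pV2 ?posrE ?mulr_gt0// ler_pM2l.
have qa_ge : ca * expR (- (h%:R / 2)) <=
    (eps * expR (- (delta * h%:R)) / (4 * (2 * h ^ 3).+1%:R)) `^ alpha.
  apply: (@le_trans _ _ ((c1 * expR (- (2 * (delta * h%:R)))) `^ alpha)).
    rewrite powRM ?expR_ge0 ?(ltW c10)// -expRM -/ca ler_pM2l// ler_expR; nra.
  apply: ge0_ler_powR; rewrite ?(ltW alpha0)// ?nnegrE//.
    by rewrite mulr_ge0 ?expR_ge0// ltW.
  by rewrite divr_ge0 ?mulr_ge0 ?expR_ge0 ?(ltW eps0).
pose y := expR (h%:R / 2 : R).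
have y1 : 1 + h%:R / 2 <= y by exact: expR_ge1Dx.
have y0 : 0 < y by rewrite expR_gt0.
have Ey : expR h%:R = y * y :> R by rewrite -expRD -splitr.
set F := Num.truncn _.
have F_gt : eps * (y * y) / 4 < F%:R + 1 by rewrite natr1 -Ey; exact: truncnS_gt.
have F0 : 0 <= F%:R :> R by [].
apply: le_trans (ler_wpM2l F0 qa_ge); rewrite expRN -/y.
have : (eps * (y * y) / 4 - 1) * (ca / y) <= F%:R * (ca / y).
  by rewrite ler_wpM2r ?divr_ge0 ?ltW//; lra.
apply: le_trans.
have -> : (eps * (y * y) / 4 - 1) * (ca / y) = ca * (eps * y / 4 - y^-1).
  by field; rewrite gt_eqF.
rewrite -ler_pdivrMl// mulrC.
have yV : y^-1 <= 1 by rewrite invf_le1//; nra.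
move: hB; rewrite ler_pdivrMr//; nra.
Qed.

Section divergence.
Context {R : realType} {d : measure_display} {S : measurableType d}.
Variables (Q : probability S R) (X : nat -> S -> int) (e : int -> R).
Variables (eps delta alpha : R).
Hypothesis e01 : forall x, 0 < e x < 1.
Hypothesis eps_gt0 : 0 < eps.
Hypothesis e_ge : forall x, eps <= e x.
Hypothesis delta_gt0 : 0 < delta.
Hypothesis alpha_gt0 : 0 < alpha.
Hypothesis delta_alpha : 2 * delta * alpha <= 1 / 2.
Hypothesis wQ : walk_in_environment Q X e 0.

Let V := potential (fun x => ln (rho (e x))).

(** For any bound [B], the terms contributed by a single valley of sufficient height already push a
    partial sum past [B]. *)
Lemma return_sum_diverges :
  (forall K, exists2 h, (K <= h)%N & exists l r : nat,
    [/\ (l <= h ^ 3)%N, (r <= h ^ 3)%N, h%:R <= V r%:Z, h%:R <= V (- l%:Z) &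
      forall x : int, - l%:Z <= x <= r%:Z -> - (delta * h%:R) <= V x]) ->
  (\sum_(1 <= n <oo) (Q [set u | X (2 * n)%N u = 0%R]) `^ alpha)%E = +oo%E.
Proof.
move=> valleys; apply: eq_infty => B.
have [K KP] := valley_contribution eps delta alpha B
  eps_gt0 delta_gt0 alpha_gt0 delta_alpha.
have [h Kh [l [r [lh rh Vr Vl Vb]]]] := valleys K.
apply: (le_trans _
  (nneseries_lim_ge (Num.truncn (eps * expR h%:R / 4)).+1 _)); last first.
  by move=> n _ _; exact: poweR_ge0.
(* [F] is the last time [n] with [4 * n <= eps * expR h], the range in which [return_prob_ge]
   applies; [q] is its lower bound with [l + r] replaced by [2 * h ^ 3]. *)
set F := Num.truncn _.
set q := eps * expR (- (delta * h%:R)) / (4 * (2 * h ^ 3).+1%:R).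
have q0 : 0 <= q by rewrite divr_ge0 ?mulr_ge0 ?expR_ge0 ?(ltW eps_gt0).
apply: (@le_trans _ _ (\sum_(1 <= n < F.+1) (q `^ alpha)%:E)%E).
  rewrite sumEFin lee_fin (le_trans (KP h Kh))// -/F -/q.
  by rewrite big_const_nat subn1 /= iter_addr_0 mulr_natl.
rewrite big_nat_cond [leRHS]big_nat_cond lee_sum// => n /andP[/andP[n1 nF] _].
have mX : measurable [set u | X (2 * n)%N u = 0] by have [] := wQ.
rewrite -(fineK (fin_num_measure Q _ mX)) poweR_EFin lee_fin.
apply: ge0_ler_powR; rewrite ?(ltW alpha_gt0)// ?nnegrE ?fine_ge0//.
apply: le_trans (return_prob_ge Q X e V eps e01 eps_gt0 e_ge _ _ wQ l r h%:R
  (delta * h%:R) n Vr Vl Vb _).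
- rewrite /q ler_pM2l ?mulr_gt0 ?expR_gt0// lef_pV2 ?posrE ?mulr_gt0 ?ltr0n//.
  by rewrite ler_pM2l// ler_nat ltnS mul2n -addnn leq_add.
- by rewrite /V /= big_ord0.
- by move=> x; exact: potentialS.
- have x0 : 0 <= eps * expR h%:R / 4 by rewrite divr_ge0// mulr_ge0 ?expR_ge0// ltW.
  have /andP[Fx _] := truncn_itv x0.
  have : n%:R <= eps * expR h%:R / 4 by rewrite (le_trans _ Fx)// ler_nat.
  by rewrite ler_pdivlMr// mulrC.
Qed.

End divergence.

(** * A bounded version of the logarithm of [rho] *)

Section log_ratio.
Context {R : realType}.

Lemma ln_rho (w : R) : 0 < w < 1 -> ln (rho w) = ln (1 - w) - ln w.
Proof.
move=> /andP[w0 w1]; rewrite /rho lnM ?posrE ?invr_gt0 ?subr_gt0//.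
by rewrite lnV ?posrE.
Qed.

(* Vanishes outside [eps, 1 - eps], so that it is bounded everywhere. *)
Definition log_ratio (eps w : R) : R :=
  (ln (1 - w) - ln w) * \1_(`[eps, 1 - eps]%classic) w.

Lemma measurable_log_ratio eps : measurable_fun setT (log_ratio eps).
Proof.
apply: measurable_funM; last exact: measurable_indic.
apply: measurable_funB; last exact: measurable_ln.
apply: measurableT_comp; first exact: measurable_ln.
exact: measurable_funB.
Qed.

Lemma log_ratioE eps w : 0 < w < 1 -> eps <= w <= 1 - eps ->
  log_ratio eps w = ln (rho w).
Proof.
move=> w01 we; rewrite ln_rho// /log_ratio indicE mem_set ?mulr1//=.
Qed.

Lemma log_ratio_bound eps w : 0 < eps < 1 -> `|log_ratio eps w| <= - ln eps.
Proof.
move=> /andP[eps0 eps1]; rewrite /log_ratio indicE.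
have lneps : ln eps <= 0 by rewrite ln_le0// ltW.
have [|_] := boolP (w \in _); last by rewrite mulr0 normr0 oppr_ge0.
rewrite inE /= in_itv /= mulr1 => /andP[w0 w1].
have l1 : ln eps <= ln w by rewrite ler_ln ?posrE//; lra.
have l2 : ln eps <= ln (1 - w) by rewrite ler_ln ?posrE; lra.
have l3 : ln w <= 0 by rewrite ln_le0//; lra.
have l4 : ln (1 - w) <= 0 by rewrite ln_le0//; lra.
by rewrite ler_norml; lra.
Qed.

End log_ratio.

Lemma identically_distributed_integral {d} {T : measurableType d} {R : realType}
    (P : probability T R) (I : choiceType) (Y : I -> {RV P >-> R})
    (g : R -> R) (c : R) (i j : I) :
  identically_distributed Y -> measurable_fun setT g ->
  (forall x, `|g x| <= c) ->
  \int[P]_t g (Y i t) = \int[P]_t g (Y j t).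
Proof.
move=> idY mg gc.
have ig k : P.-integrable setT ((EFin \o g) \o Y k).
  by apply: (bounded_integrable P (g \o Y k) c) => [|t];
    [exact: measurableT_comp|exact: gc].
have mEg : measurable_fun setT (EFin \o g) by exact/measurable_EFinP.
rewrite /Rintegral; congr fine.
transitivity (\int[distribution P (Y i)]_x (EFin \o g) x)%E.
  by rewrite integral_distribution.
transitivity (\int[distribution P (Y j)]_x (EFin \o g) x)%E; last first.
  by rewrite integral_distribution.
by apply: eq_measure_integral => A mA _; exact: idY.
Qed.

Lemma ae_forall_int {d} {T : measurableType d} {R : realType}
    (mu : {measure set T -> \bar R}) (p : int -> T -> Prop) :
  (forall x, {ae mu, forall t, p x t}) -> {ae mu, forall t, forall x, p x t}.
Proof.
move=> aep.
have pos := ae_foralln (fun n => aep (Posz n)).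
have neg := ae_foralln (fun n => aep (Negz n)).
by apply: filterS2 pos neg => t tpos tneg [].
Qed.

(** * Divergence for almost every environment *)

Theorem theorem4p2 (R : realType)
  (d : measure_display) (T : measurableType d) (P : probability T R)
  (omega : int -> {RV P >-> R})
  (homega01 : forall (x : int) (t : T), 0 < omega x t < 1)
  (hiid : iid omega)
  (hmean : ('E_P[fun t : T => ln (rho (omega 0%R t))] = 0)%E)
  (hell : exists eps : R, 0 < eps < 1 / 2 /\
     P [set t | eps <= omega 0 t <= 1 - eps] = 1%E)
  (hvar : (0 < 'V_P[fun t : T => ln (rho (omega 0%R t))])%E)
  (dS : measure_display) (S : measurableType dS) (X : nat -> S -> int)
  (PQ : (int -> R) -> int -> probability S R)
  (hPQ : quenched_laws X PQ)
  (alpha : R) (halpha : 0 < alpha) :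
  {ae P, forall t : T,
     (\sum_(1 <= n <oo)
        (PQ (fun x : int => omega x t) 0%R
            [set u | X (2 * n)%N u = 0%R]) `^ alpha)%E
     = +oo%E}.
Proof.
have [eps [/andP[eps0 eps2] Peps]] := hell; have [indY idY] := hiid.
have eps01 : 0 < eps < 1 by apply/andP; split => //; lra.
have mE x : measurable (omega x @^-1` `[eps, 1 - eps]%classic).
  by rewrite -[X in measurable X]setTI; exact: measurable_funPT.
have EE x : omega x @^-1` `[eps, 1 - eps]%classic =
    [set t | eps <= omega x t <= 1 - eps].
  by apply/seteqP; split => t /=; rewrite in_itv.
(* Ellipticity at site 0 passes to every site by equality of laws, and to all sites at once by
   countability. *)
have ell : {ae P, forall t, forall x, eps <= omega x t <= 1 - eps}.
  apply: ae_forall_int => x.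
  exists (~` (omega x @^-1` `[eps, 1 - eps]%classic)); split.
  - exact: measurableC.
  - apply: (etrans (probability_setC P (mE x))).
    have -> : P (omega x @^-1` `[eps, 1 - eps]%classic) = 1%E.
      by rewrite -Peps -EE; exact: (idY x 0).
    by rewrite subee.
  - by apply: subsetC; rewrite EE.
pose f := log_ratio eps; pose c := - ln eps.
have mf : measurable_fun setT f by exact: measurable_log_ratio.
have fc x : `|f x| <= c by exact: log_ratio_bound.
have c0 : 0 <= c by rewrite (le_trans _ (fc 0)).
pose xi t := ln (rho (omega 0 t)).
have mxi : measurable_fun setT xi.
  rewrite (_ : xi = fun t => ln (1 - omega 0 t) - ln (omega 0 t)).
    apply: measurable_funB; apply: measurableT_comp => //; try exact: measurable_ln.
    exact: measurable_funB.
  by apply/funext => t; rewrite /xi ln_rho.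
have mfo i : measurable_fun setT (fun t => f (omega i t)).
  exact: measurableT_comp.
have xif : {ae P, forall t, xi t = f (omega 0 t)}.
  by apply: filterS ell => t tell; rewrite /f log_ratioE.
have f_mean i : \int[P]_t f (omega i t) = 0.
  rewrite (identically_distributed_integral P _ omega f c i 0)//.
  move: hmean; rewrite unlock => m0; rewrite /Rintegral.
  rewrite (ae_eq_integral (fun t => (xi t)%:E)) ?m0//.
  - exact/measurable_EFinP.
  - exact/measurable_EFinP.
  - by apply: filterS xif => t -> _.
pose v := \int[P]_t (f (omega 0 t) ^+ 2).
have mf2 : measurable_fun setT (fun x => f x ^+ 2) by exact: measurable_funX.
have f2c x : `|f x ^+ 2| <= c ^+ 2 by rewrite normrX lerXn2r ?nnegrE.
have f_var i : \int[P]_t (f (omega i t) ^+ 2) = v.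
  exact: (identically_distributed_integral P _ omega (fun x => f x ^+ 2) (c ^+ 2)).
(* The mean is 0, so the second moment is the variance; [f] and the true logarithm agree almost
   surely. *)
have v0 : 0 < v.
  have vE : (\int[P]_t (f (omega 0 t) ^+ 2)%:E)%E = v%:E.
    rewrite /v /Rintegral fineK// integrable_fin_num//.
    apply: (bounded_integrable P (fun t => f (omega 0 t) ^+ 2) (c ^+ 2)) => //.
    exact: measurable_funX.
  rewrite -lte_fin -vE; move: hvar; rewrite /variance covariance.unlock hmean/=.
  rewrite expectation.unlock (ae_eq_integral (fun t => (f (omega 0 t) ^+ 2)%:E))//.
  - apply/measurable_EFinP; apply: measurable_funM; apply: measurable_funB => //.
  - by apply/measurable_EFinP/measurable_funX.
  - apply: filterS xif => t xit _; congr EFin.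
    by rewrite -xit expr2 -[LHS]/((xi t - 0) * (xi t - 0)) subr0.
(* This makes [2 * delta * alpha <= 1 / 2], while the summand 1 keeps [delta <= 1]. *)
pose delta := (4 * alpha + 1)^-1.
have da0 : 0 < 4 * alpha + 1 by lra.
have delta01 : 0 < delta <= 1.
  by rewrite /delta invr_gt0 invf_le1// da0/=; lra.
have da : 2 * delta * alpha <= 1 / 2.
  by rewrite /delta mulrAC ler_pdivrMr//; lra.
have /andP[delta0 _] := delta01.
have val := valley_io omega f delta c v indY mf fc f_mean f_var v0 c0 delta01.
apply: filterS2 ell val => t tell tval.
apply: (return_sum_diverges _ X (fun x => omega x t) eps delta alpha) => //.
- by move=> x; have /andP[] := tell x.
- by apply: hPQ => x.
move=> K; have [h Kh [[r /= rh [Vr Vrb]] [l /= lh [Vl Vlb]]]] := tval K.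
have rE n : partial_sum omega f right_site n t =
    potential (fun x => ln (rho (omega x t))) n%:Z.
  by rewrite /partial_sum /=; apply: eq_bigr => k _; rewrite /f log_ratioE.
have lE n : partial_sum omega (fun x => - f x) left_site n t =
    potential (fun x => ln (rho (omega x t))) (- n%:Z).
  by rewrite potentialN /partial_sum; apply: eq_bigr => k _; rewrite /f log_ratioE.
exists h => //; exists l, r; split.
- exact: lh.
- exact: rh.
- by move: Vr; rewrite rE.
- by move: Vl; rewrite lE.
move=> [n|n] /andP[ln nr].
  by rewrite -rE; apply: Vrb.
have -> : Negz n = - n.+1%:Z by [].
by rewrite -lE; apply: Vlb => /=; clear -ln; lia.
Qed.
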